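(* Let $({\bm w}_j^0)_{j\ge1}$ be a sequence of i.i.d. random variables with law $\pi_0$, and let $f^*$ be a continuous function on $X$. Assume there exist a constant $C$ and a sequence of real numbers $(a_j)_{j\ge1}$ with $\sup_j|a_j|\le C$ such that \[ \lim_{m\to\infty}\frac1m\sum_{j=1}^m a_j\phi({\bm x};{\bm w}_j^0)=f^*({\bm x})\quad\text{for all }{\bm x}\in X. \] Then, with probability $1$ (over the sequence $({\bm w}_j^0)$), there exists a measurable function $a^*:\Omega\to\mathbb{R}$ with $|a^*({\bm w})|\le C$ for $\pi_0$-a.e. ${\bm w}$ such that \[ f^*({\bm x})=\int_\Omega a^*({\bm w})\phi({\bm x};{\bm w})\,d\pi_0({\bm w})\quad\text{for all }{\bm x}\in X. \] In particular $\|f^*\|_\infty\le C$.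
   Context: $X=[0,1]^d$; $\Omega\subset\mathbb{R}^p$ is compact; $\pi_0$ is a probability distribution with support $\Omega$; $\phi:X\times\Omega\to\mathbb{R}$ is continuous and bounded. For a function $f$ on $X$, $\|f\|_\infty:=\inf\{\|a\|_{L^\infty(\pi_0)}: f({\bm x})=\int a({\bm w})\phi({\bm x};{\bm w})d\pi_0({\bm w})\ \forall{\bm x}\in X\}$. *)

(* Defs.v *)
From HB Require Import structures.
From mathcomp Require Import all_boot all_order all_algebra.
From mathcomp Require Import all_classical all_reals all_analysis.
Set Implicit Arguments. Unset Strict Implicit. Unset Printing Implicit Defensive.
Import Order.TTheory GRing.Theory Num.Theory.
Import numFieldNormedType.Exports.
Local Open Scope classical_set_scope.
Local Open Scope ring_scope.

Definition borel_rV (R : realType) (p : nat) :=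
  g_sigma_algebraType (@open 'rV[R]_p).

Definition unit_cube (R : realType) (d : nat) : set 'rV[R]_d :=
  [set x | forall i : 'I_d, 0 <= x ord0 i <= 1].
Arguments unit_cube : clear implicits.

Definition msupport (R : realType) (p : nat)
  (mu : set (borel_rV R p) -> \bar R) : set 'rV[R]_p :=
  [set w | forall U : set 'rV[R]_p, open U -> U w -> (0 < mu U)%E].

Definition iid_seq (R : realType) (dT : measure_display) (T : measurableType dT)
  (P : probability T R) (p : nat) (pi0 : probability (borel_rV R p) R)
  (W : nat -> T -> borel_rV R p) : Prop :=
  (forall j, measurable_fun setT (W j)) /\
  (forall j (A : set (borel_rV R p)), measurable A ->
      P (W j @^-1` A) = pi0 A) /\
  (forall (s : seq nat) (A : nat -> set (borel_rV R p)), uniq s ->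
      (forall j, j \in s -> measurable (A j)) ->
      P (\bigcap_(j in [set j | j \in s]) (W j @^-1` A j)) =
      (\prod_(j <- s) P (W j @^-1` A j))%E).

(* Main.v *)
Require Import Defs.
From HB Require Import structures.
From mathcomp Require Import all_boot all_order all_algebra.
From mathcomp Require Import all_classical all_reals all_analysis.
From mathcomp Require Import measurable_realfun ring lra.
Import Order.TTheory GRing.Theory Num.Theory.
Import numFieldNormedType.Exports.
Local Open Scope classical_set_scope.
Local Open Scope ring_scope.

(** The function [astar] is the density of a weak limit of the signed measures
    [m^-1 * \sum_(j < m) a j * delta_(W j)].  A countable base [B] of the
    topology gives, for each [n], the finite partition into the atoms of
    [B 0, .., B n.-1].  Almost surely the empirical frequencies of all these
    atoms converge to their [pi0]-measures along [m = 8 ^ k].  A limit [nu0]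
    along an ultrafilter of the signed measures of the atoms then satisfies
    [`|nu0 Q| <= C * pi0 Q].  Spreading the mass of each atom proportionally to
    [pi0] and passing to the limit in [n] along the same ultrafilter extends
    [nu0] to a finitely additive set function bounded by [C * pi0] on all Borel
    sets.  Such a function is automatically countably additive, so it has a
    Radon-Nikodym density, bounded by [C].  By compactness of [Omega],
    [phi (x, _)] is uniformly approximated by functions constant on the atoms,
    which transfers the limit from atoms to [phi (x, _)]. *)

(** * Generalized limits of bounded real sequences *)

Definition bounded_seq {R : realType} (u : nat -> R) :=
  exists M : R, forall n, `|u n| <= M.

(** A Banach limit without shift invariance. The bound in the second clause is asked only
    eventually, so finitely many terms do not influence [L] on bounded sequences. *)
Definition generalized_limit {R : realType} (L : (nat -> R) -> R) :=
  [/\ forall u v c, bounded_seq u -> bounded_seq v ->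
        L (fun n => u n + c * v n) = L u + c * L v,
      forall u c, (\forall n \near \oo, `|u n| <= c) -> `|L u| <= c
    & forall u l, u @ \oo --> l -> L u = l].

(** Compactness of [[-M, M]] gives the image of [U] a cluster point, and an ultrafilter converges to
    its cluster points. *)
Lemma bounded_ultra_cvg {R : realType} (U : set_system nat) (u : nat -> R)
    (M : R) : UltraFilter U -> (\forall n \near U, `|u n| <= M) -> cvg (u @ U).
Proof.
move=> UU uM; have PU : ProperFilter U by exact: ultra_proper.
have [] := @segment_compact R (- M) M (u @ U) _.
  by apply: filterS uM => n; rewrite /= ler_norml in_itv.
move=> p [_ clp]; apply/cvg_ex; exists p => V Vp.
(* If the preimage of [V] is not in [U], its complement is, which contradicts that [p] is a cluster
   point. *)
have [//|UVC] := in_ultra_setVsetC (u @^-1` V) UU.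
by have [x []] := clp (~` V) V UVC Vp.
Qed.

(** The limit along any ultrafilter finer than [\oo] works; [lim] is total, so sequences that
    diverge along it merely receive a default value. *)
Lemma ex_generalized_limit (R : realType) :
  exists L : (nat -> R) -> R, generalized_limit L.
Proof.
have [U [UU sU]] := @ultraFilterLemma nat (nbhs \oo) _.
have PU : ProperFilter U by exact: ultra_proper.
have bcvg (u : nat -> R) : bounded_seq u -> cvg (u @ U).
  by move=> [M uM]; apply: (@bounded_ultra_cvg R U u M) => //; exact: nearW.
exists (fun u => lim (u @ U)); split.
- move=> u v c bu bv; apply: cvg_lim => //.
  apply: cvgD; first exact: bcvg.
  by apply: cvgM; [exact: cvg_cst|exact: bcvg].
- move=> u c uc; have uUc : \forall n \near U, `|u n| <= c by exact: sU.
  rewrite -lim_norm; last exact: bounded_ultra_cvg uUc.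
  apply: limr_le => //; apply: is_cvg_norm; exact: bounded_ultra_cvg uUc.
- move=> u l ul; apply: cvg_lim => //.
  by apply: cvg_trans ul => A; exact: sU.
Qed.

Lemma bounded_seqD {R : realType} (u v : nat -> R) :
  bounded_seq u -> bounded_seq v -> bounded_seq (fun n => u n + v n).
Proof.
move=> [M uM] [N vN]; exists (M + N) => n.
by rewrite (le_trans (ler_normD _ _))// lerD.
Qed.

Lemma bounded_seqZ {R : realType} (c : R) (u : nat -> R) :
  bounded_seq u -> bounded_seq (fun n => c * u n).
Proof.
by move=> [M uM]; exists (`|c| * M) => n; rewrite normrM ler_wpM2l.
Qed.

Lemma bounded_seq_sum {R : realType} {I : Type} (s : seq I)
    (c : I -> R) (u : I -> nat -> R) : (forall i, bounded_seq (u i)) ->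
  bounded_seq (fun n => \sum_(i <- s) c i * u i n).
Proof.
move=> bu; elim: s => [|i s IH].
  by exists 0 => n; rewrite big_nil normr0.
under eq_fun do rewrite big_cons.
by apply: bounded_seqD => //; exact: bounded_seqZ.
Qed.

Lemma generalized_limit_sum {R : realType} (L : (nat -> R) -> R)
    {I : Type} (s : seq I) (c : I -> R) (u : I -> nat -> R) :
  generalized_limit L -> (forall i, bounded_seq (u i)) ->
  L (fun n => \sum_(i <- s) c i * u i n) = \sum_(i <- s) c i * L (u i).
Proof.
move=> [Llin _ Lcvg] bu; elim: s => [|i s IH].
  rewrite big_nil; under eq_fun do rewrite big_nil.
  by apply: Lcvg; exact: cvg_cst.
rewrite big_cons; under eq_fun do rewrite big_cons addrC.
rewrite Llin//; last exact: bounded_seq_sum.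
by rewrite IH addrC.
Qed.

(** * Set functions dominated by a probability, and their densities *)

(* Finite additivity upgrades to countable additivity because the tails are
   controlled by the tails of [mu]. *)
Lemma dominated_semi_sigma_additive {d} {T : measurableType d} {R : realType}
    (mu : probability T R) (nu : set T -> R) (C : R) :
  (forall A B, measurable A -> measurable B -> A `&` B = set0 ->
     nu (A `|` B) = nu A + nu B) ->
  (forall A, measurable A -> `|nu A| <= C * fine (mu A)) ->
  semi_sigma_additive (fun A => (nu A)%:E).
Proof.
move=> nuU nuC F mF tF mU.
have nu0 : nu set0 = 0.
  by have := nuC _ measurable0; rewrite measure0 mulr0 normr_le0 => /eqP.
have mfin A : measurable A -> (fine (mu A))%:E = mu A.
  by move=> mA; rewrite fineK// fin_num_measure.
pose G n := \big[setU/set0]_(i < n) F i.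
have mG n : measurable (G n) by exact: bigsetU_measurable.
have GFd n : G n `&` F n = set0.
  rewrite /G -bigcup_mkord setI_bigcupl; apply: bigcup0 => i /= ltin.
  by move/trivIsetP : tF; apply => //; rewrite ltn_eqF.
have GU n : G n `<=` \bigcup_k F k.
  by move=> x; rewrite /G -bigcup_mkord => -[k _ Fk]; exists k.
have nuG n : nu (G n) = \sum_(0 <= i < n) nu (F i).
  elim: n => [|n IH]; first by rewrite /G big_ord0 big_geq.
  rewrite big_nat_recr//= -IH -nuU//; congr nu.
  by rewrite /G big_ord_recr.
(* By additivity the left side is [nu] of the tail, and the right side is [C] times the [mu]-measure
   of the same tail. *)
have nutail n : `|nu (\bigcup_k F k) - nu (G n)| <=
    C * (fine (mu (\bigcup_k F k)) - fine (mu (G n))).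
  have mD : measurable ((\bigcup_k F k) `\` G n) by exact: measurableD.
  have -> : nu (\bigcup_k F k) = nu (G n) + nu ((\bigcup_k F k) `\` G n).
    rewrite -nuU//; last by rewrite setDE setICA setICr setI0.
    by rewrite setDUK.
  rewrite addrAC subrr add0r (le_trans (nuC _ mD))// le_eqVlt; apply/orP; left.
  apply/eqP; congr (C * _); apply: EFin_inj; rewrite EFinB !mfin//.
  rewrite measureD// ?(setIidr (GU n))//.
  by rewrite -ge0_fin_numE// fin_num_measure.
have muS : fine (mu (G n)) @[n --> \oo] --> fine (mu (\bigcup_k F k)).
  apply: fine_cvg; rewrite mfin//.
  under eq_fun do rewrite /G measure_bigsetU// -(big_mkord xpredT (mu \o F)).
  exact: measure_semi_sigma_additive.
apply: cvg_EFin; first by apply: nearW => n; rewrite sumEFin.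
under eq_fun do rewrite /= sumEFin /= -nuG.
apply/subr_cvg0/norm_cvg0P.
apply: (@squeeze_cvgr _ _ _ _ (cst 0) (fun n =>
    C * (fine (mu (\bigcup_k F k)) - fine (mu (G n))))).
- by near=> n; rewrite normr_ge0/= distrC nutail.
- exact: cvg_cst.
- rewrite -[X in _ --> X](mulr0 C) -[X in _ --> C * X](subrr (fine (mu (\bigcup_k F k)))).
  by apply: cvgM; [exact: cvg_cst|apply: cvgB => //; exact: cvg_cst].
Unshelve. all: by end_near. Qed.

(** Testing the hypothesis on [[set x | C < h x]] forces the integral of the positive function
    [h - C] over this set to vanish, so the set is null. *)
Lemma ae_le_of_Rintegral_le {d} {T : measurableType d} {R : realType}
    (mu : probability T R) (h : T -> R) (C : R) :
  mu.-integrable setT (EFin \o h) ->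
  (forall A, measurable A -> \int[mu]_(x in A) h x <= C * fine (mu A)) ->
  {ae mu, forall x, h x <= C}.
Proof.
move=> hi hC; have mh : measurable_fun setT h.
  by apply/measurable_EFinP; exact: measurable_int hi.
pose B := [set x | C < h x].
have mB : measurable B.
  rewrite -[B]setTI; have : measurable_fun setT (fun x => C < h x).
    by apply: measurable_fun_ltr => //; exact: measurable_cst.
  by move=> /(_ measurableT [set true] I); congr measurable; apply/seteqP.
have hBi : mu.-integrable B (EFin \o h) by exact: integrableS hi.
have cBi : mu.-integrable B (EFin \o cst C).
  exact: finite_measure_integrable_cst.
have hCi : mu.-integrable B (EFin \o (fun x => h x - C)).
  exact: (integrableB mB hBi cBi).
have int0 : (\int[mu]_(x in B) `|(h x - C)%:E|)%E = 0%E.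
  transitivity (\int[mu]_(x in B) (h x - C)%:E)%E.
    apply: eq_integral => x /[1!inE] Bx.
    by rewrite /= ger0_norm// subr_ge0 ltW.
  apply/eqP; rewrite eq_le; apply/andP; split; last first.
    by apply: integral_ge0 => x Bx; rewrite lee_fin subr_ge0 ltW.
  rewrite -[leLHS]fineK; last exact: integrable_fin_num.
  rewrite lee_fin -/(Rintegral mu B (fun x => h x - C)) RintegralB//.
  by rewrite Rintegral_cst// subr_le0 hC.
have B0 := (ae_eq_integral_abs mu mB (measurable_int _ hCi)).1 int0.
apply: negligibleS B0 => x /= /negP; rewrite -ltNge => Bx /(_ Bx) [] /eqP.
by rewrite subr_eq0 gt_eqF.
Qed.

(** Domination makes [nu] a charge absolutely continuous with respect to [mu]. The one-sided bound,
    applied to [h] and to [- h], controls its Radon-Nikodym derivative. *)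
Lemma bounded_charge_density {d} {T : measurableType d} {R : realType}
    (mu : probability T R) (nu : set T -> R) (C : R) :
  0 <= C ->
  (forall A B, measurable A -> measurable B -> A `&` B = set0 ->
     nu (A `|` B) = nu A + nu B) ->
  (forall A, measurable A -> `|nu A| <= C * fine (mu A)) ->
  exists a : T -> R, [/\ measurable_fun setT a, forall w, `|a w| <= C
    & forall A, measurable A -> (\int[mu]_(x in A) a x)%R = nu A].
Proof.
move=> C0 nuU nuC.
have nu0 : nu set0 = 0.
  by have := nuC _ measurable0; rewrite measure0 mulr0 normr_le0 => /eqP.
pose nuE A := (nu A)%:E.
have nuE0 : nuE set0 = 0%E by rewrite /nuE nu0.
have nuEfin A : measurable A -> nuE A \is a fin_num by [].
have nuEsig : semi_sigma_additive nuE.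
  exact: dominated_semi_sigma_additive nuU nuC.
pose c := isCharge.Build _ _ _ nuE nuE0 nuEfin nuEsig.
pose nuc : {charge set T -> \bar R} := HB.pack nuE c.
have dom : nuc `<< mu.
  move=> A A0 B mB BA; congr EFin; apply/eqP; rewrite -normr_le0.
  by rewrite (le_trans (nuC _ mB))// A0// mulr0.
pose g := Radon_Nikodym nuc mu.
have gi : mu.-integrable setT g by exact: Radon_Nikodym_integrable.
have gfin x : g x \is a fin_num by exact: Radon_Nikodym_fin_num.
have gE A : measurable A -> nuE A = (\int[mu]_(x in A) g x)%E.
  by move=> mA; exact: (Radon_Nikodym_integral dom mA).
pose h := fine \o g.
have mh : measurable_fun setT h.
  apply: measurableT_comp => //; exact: measurable_int gi.
have hE x : (h x)%:E = g x by rewrite fineK.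
have hi A : measurable A -> mu.-integrable A (EFin \o h).
  by move=> mA; rewrite (_ : _ \o _ = g); [exact: integrableS gi|exact/funext].
have hA A : measurable A -> \int[mu]_(x in A) h x = nu A.
  move=> mA; rewrite /Rintegral; apply: EFin_inj.
  rewrite -[RHS]/(nuE A) gE//; under eq_integral do rewrite hE.
  by rewrite fineK// -gE.
have mh1 : {ae mu, forall x, h x <= C}.
  apply: ae_le_of_Rintegral_le; first exact: hi.
  by move=> A mA; rewrite hA// (le_trans (ler_norm _))// nuC.
have mh2 : {ae mu, forall x, - h x <= C}.
  apply: ae_le_of_Rintegral_le.
    rewrite (_ : _ \o _ = (\- (EFin \o h))%E)//; exact/integrableN/hi.
  move=> A mA; under eq_Rintegral do rewrite -mulN1r.
  rewrite RintegralZl//; last exact: hi.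
  by rewrite hA// mulN1r (le_trans (ler_norm _))// normrN nuC.
(* So far the bound on [h] holds only almost everywhere. Setting [h] to zero off the full set [D]
   makes it hold everywhere and keeps all integrals. *)
pose D := [set x | `|h x| <= C].
have mD : measurable D.
  have : measurable_fun setT (fun x => `|h x| <= C).
    apply: measurable_fun_ler => //; first exact: measurableT_comp.
  rewrite -[D]setTI.
  by move=> /(_ measurableT [set true] I); congr measurable; apply/seteqP.
have mD0 : mu (~` D) = 0%E.
  apply/negligibleP; first exact: measurableC.
  by apply: filterS2 mh1 mh2 => x h1 h2; rewrite /D/= ler_norml lerNl h1 h2.
exists (h \_ D); split.
- apply/(measurable_restrictT h mD).1; exact: measurable_funTS mh.
- by move=> w; rewrite patchE; case: ifPn; rewrite ?normr0// inE.
- move=> A mA; rewrite -Rintegral_mkcondr hA; last exact: measurableI.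
  have mAD : measurable (A `\` D) by exact: measurableD.
  have -> : nu A = nu (A `&` D) + nu (A `\` D).
    rewrite -nuU//; last by rewrite setDE setIACA setICr setI0.
      by rewrite setUIDK.
    exact: measurableI.
  rewrite [X in _ + X](_ : _ = 0) ?addr0//.
  apply/eqP; rewrite -normr_le0 (le_trans (nuC _ mAD))//.
  rewrite (_ : mu _ = 0%E) ?mulr0//; apply: subset_measure0 mD0 => //.
  exact: measurableC.
Qed.


(** * Bounded measurable functions and their integrals *)

(** This class is stable under sums and products and consists of integrable functions, so
    integrability side conditions reduce to membership in it. *)
Definition bounded_measurable {d} {T : measurableType d} {R : realType}
    (f : T -> R) :=
  measurable_fun setT f /\ exists M : R, forall x, `|f x| <= M.

Lemma bounded_measurableD {d} {T : measurableType d} {R : realType}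
    (f g : T -> R) : bounded_measurable f -> bounded_measurable g ->
  bounded_measurable (fun x => f x + g x).
Proof.
move=> [mf [M fM]] [mg [N gN]]; split; first exact: measurable_funD.
by exists (M + N) => x; rewrite (le_trans (ler_normD _ _))// lerD.
Qed.

Lemma bounded_measurableM {d} {T : measurableType d} {R : realType}
    (f g : T -> R) : bounded_measurable f -> bounded_measurable g ->
  bounded_measurable (fun x => f x * g x).
Proof.
move=> [mf [M fM]] [mg [N gN]]; split; first exact: measurable_funM.
by exists (M * N) => x; rewrite normrM ler_pM.
Qed.

Lemma bounded_measurable_cst {d} {T : measurableType d} {R : realType} (c : R) :
  bounded_measurable (fun _ : T => c).
Proof. by split; [exact: measurable_cst|exists `|c|]. Qed.

Lemma bounded_measurable_indic {d} {T : measurableType d} {R : realType}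
    (A : set T) : measurable A -> bounded_measurable (\1_A : T -> R).
Proof.
move=> mA; split; first exact: measurable_indic.
by exists 1 => x; rewrite indicE; case: (_ \in _); rewrite ?normr1 ?normr0.
Qed.

Lemma bounded_measurable_sum {d} {T : measurableType d} {R : realType}
    {I : Type} (s : seq I) (f : I -> T -> R) :
  (forall i, bounded_measurable (f i)) ->
  bounded_measurable (fun x => \sum_(i <- s) f i x).
Proof.
move=> bf; elim: s => [|i s IH].
  by under eq_fun do rewrite big_nil; exact: bounded_measurable_cst.
by under eq_fun do rewrite big_cons; exact: bounded_measurableD.
Qed.

Lemma bounded_measurable_integrable {d} {T : measurableType d} {R : realType}
    (mu : probability T R) (D : set T) (f : T -> R) : measurable D ->
  bounded_measurable f -> mu.-integrable D (EFin \o f).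
Proof.
move=> mD [mf [M fM]]; apply: (integrableS measurableT mD (@subsetT _ _)).
apply: measurable_bounded_integrable => //.
  by rewrite -ge0_fin_numE// fin_num_measure.
by exists M; split; [exact: num_real|move=> x Mx y _; rewrite /= (le_trans (fM y))// ltW].
Qed.

Lemma Rintegral_sum {d} {T : measurableType d} {R : realType}
    (mu : probability T R) (D : set T) {I : Type} (s : seq I) (f : I -> T -> R) :
  measurable D -> (forall i, bounded_measurable (f i)) ->
  \int[mu]_(x in D) (\sum_(i <- s) f i x) = \sum_(i <- s) \int[mu]_(x in D) f i x.
Proof.
move=> mD bf; elim: s => [|i s IH].
  under eq_Rintegral do rewrite big_nil.
  by rewrite big_nil Rintegral_cst// mul0r.
under eq_Rintegral do rewrite big_cons.
rewrite big_cons RintegralD ?IH//; apply: bounded_measurable_integrable => //.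
exact: bounded_measurable_sum.
Qed.

Lemma Rintegral_indic_setT {d} {T : measurableType d} {R : realType}
    (mu : probability T R) (A : set T) : measurable A ->
  \int[mu]_x (\1_A x) = fine (mu A).
Proof. by move=> mA; rewrite /Rintegral integral_indic// setIT. Qed.

Lemma Rintegral_cst_setT {d} {T : measurableType d} {R : realType}
    (mu : probability T R) (c : R) : \int[mu]_(x in setT) c = c.
Proof.
have := probability_setT mu; rewrite Rintegral_cst//= => ->.
by rewrite mulr1.
Qed.

(** * Law of large numbers for pairwise independent events *)

Lemma Rintegral_centered_indicM {d} {T : measurableType d} {R : realType}
    (P : probability T R) (A B : set T) (q : R) :
  measurable A -> measurable B -> P A = q%:E -> P B = q%:E ->
  \int[P]_x ((\1_A x - q) * (\1_B x - q)) = fine (P (A `&` B)) - q ^+ 2.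
Proof.
move=> mA mB PA PB; have mAB := measurableI _ _ mA mB.
have [c cE] : exists c, c = q ^+ 2 by exists (q ^+ 2).
have E x : (\1_A x - q) * (\1_B x - q) =
    \1_(A `&` B) x + (- q * \1_A x + (- q * \1_B x + c)) :> R.
  by rewrite indicI/= cE; ring.
under eq_Rintegral do rewrite E.
have bi (C : set T) : measurable C -> bounded_measurable (\1_C : T -> R).
  exact: bounded_measurable_indic.
have bZ (C : set T) b : measurable C -> bounded_measurable (fun x => b * \1_C x : R).
  by move=> mC; apply: bounded_measurableM; [exact: bounded_measurable_cst|exact: bi].
have bq : bounded_measurable (fun _ : T => c) by exact: bounded_measurable_cst.
have ib := fun f => @bounded_measurable_integrable _ _ _ P setT f measurableT.
rewrite RintegralD//; [|by apply/ib/bi|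
  by apply: ib; repeat apply: bounded_measurableD; by [|exact: bZ]].
rewrite RintegralD//; [|by apply/ib/bZ|
  by apply: ib; repeat apply: bounded_measurableD; by [|exact: bZ]].
rewrite RintegralD//; [|by apply/ib/bZ|by apply: ib].
rewrite !RintegralZl ?Rintegral_indic_setT ?Rintegral_cst_setT//; try by apply/ib/bi.
by rewrite PA PB cE/=; ring.
Qed.

(** After expanding the square, the off-diagonal covariances vanish, and each of the [n] diagonal
    terms is [q - q ^+ 2], at most 1. *)
Lemma pairwise_indep_variance {d} {T : measurableType d} {R : realType}
    (P : probability T R) (A : nat -> set T) (q : R) (n : nat) :
  (forall i, measurable (A i)) -> (forall i, P (A i) = q%:E) ->
  (forall i j, i != j -> P (A i `&` A j) = (q * q)%:E) ->
  \int[P]_x ((\sum_(i < n) (\1_(A i) x - q)) ^+ 2) <= n%:R.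
Proof.
move=> mA PA PAA.
have bZ i : bounded_measurable (fun x => \1_(A i) x - q).
  apply: bounded_measurableD; first exact: bounded_measurable_indic.
  exact: bounded_measurable_cst.
under eq_Rintegral do rewrite expr2 big_distrlr/=.
rewrite Rintegral_sum//; last first.
  move=> i; apply: bounded_measurable_sum => j; exact: bounded_measurableM.
rewrite -[n in leRHS]card_ord -sumr_const.
apply: ler_sum => i _; rewrite Rintegral_sum//; last first.
  by move=> j; exact: bounded_measurableM.
rewrite (bigD1 i)//= big1 ?addr0; last first.
  move=> j ji; rewrite Rintegral_centered_indicM// PAA//= ?expr2 ?subrr//.
  by rewrite eq_sym.
rewrite Rintegral_centered_indicM// setIid PA/=.
have : (q%:E <= 1)%E by rewrite -(PA 0%N) probability_le1.
by rewrite lee_fin => q1; rewrite lerBlDr (le_trans q1)// lerDl sqr_ge0.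
Qed.

(** Chebyshev's inequality: integrate the pointwise bound of [\1_B * e ^+ 2] by the squared sum. *)
Lemma pairwise_indep_chebyshev {d} {T : measurableType d} {R : realType}
    (P : probability T R) (A : nat -> set T) (q e : R) (n : nat) :
  0 < e ->
  (forall i, measurable (A i)) -> (forall i, P (A i) = q%:E) ->
  (forall i j, i != j -> P (A i `&` A j) = (q * q)%:E) ->
  let B := [set x | e <= `|\sum_(i < n) (\1_(A i) x - q)|] in
  measurable B /\ (P B <= (n%:R / e ^+ 2)%:E)%E.
Proof.
move=> e0 mA PA PAA B; pose S x : R := \sum_(i < n) (\1_(A i) x - q).
have bS : bounded_measurable S.
  apply: bounded_measurable_sum => i; apply: bounded_measurableD.
    exact: bounded_measurable_indic.
  exact: bounded_measurable_cst.
have mB : measurable B.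
  have : measurable_fun setT (fun x => e <= `|S x|).
    by apply: measurable_fun_ler => //; apply: measurableT_comp => //; case: bS.
  rewrite -[B]setTI.
  by move=> /(_ measurableT [set true] I); congr measurable; apply/seteqP.
split => //; rewrite -[P B]fineK ?fin_num_measure// lee_fin.
rewrite ler_pdivlMr ?exprn_gt0// (le_trans _ (pairwise_indep_variance P A q n mA PA PAA))//.
have bB : bounded_measurable (\1_B : T -> R) by exact: bounded_measurable_indic.
have ib := fun f => @bounded_measurable_integrable _ _ _ P setT f measurableT.
rewrite -Rintegral_indic_setT// -RintegralZr//; last exact: ib.
apply: le_Rintegral => //.
- by apply/ib/bounded_measurableM => //; exact: bounded_measurable_cst.
- by apply/ib/bounded_measurableM.
- move=> x _; rewrite indicE; case: (boolP (x \in B)) => [|_]; last first.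
    by rewrite mul0r sqr_ge0.
  rewrite inE /B/= => h.
  by rewrite mul1r -[leRHS]real_normK ?num_real// lerXn2r// nnegrE// ltW.
Qed.

(* Restricting to the sample sizes [8 ^ k] makes the Chebyshev bounds summable. *)
Lemma pairwise_indep_slln {d} {T : measurableType d} {R : realType}
    (P : probability T R) (A : nat -> set T) (q : R) :
  (forall i, measurable (A i)) -> (forall i, P (A i) = q%:E) ->
  (forall i j, i != j -> P (A i `&` A j) = (q * q)%:E) ->
  {ae P, forall t, (fun k => (8 ^ k)%:R^-1 * \sum_(j < 8 ^ k) \1_(A j) t)
    @ \oo --> q}.
Proof.
move=> mA PA PAA.
pose S n x : R := \sum_(i < n) (\1_(A i) x - q).
(* The mean may deviate by [1 / 2 ^ k], so Chebyshev bounds [P (F k)] by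
   [8 ^ k / (8 ^ k / 2 ^ k) ^ 2 = 1 / 2 ^ k]. *)
pose F k := [set x | (8 ^ k)%:R / (2 ^ k)%:R <= `|S (8 ^ k)%N x|].
have e0 k : 0 < (8 ^ k)%:R / (2 ^ k)%:R :> R.
  by rewrite divr_gt0// ltr0n expn_gt0.
have mF k : measurable (F k).
  by have [] := pairwise_indep_chebyshev P A q _ (8 ^ k)%N (e0 k) mA PA PAA.
(* This is [1 / 2 ^ k], written in the form of the series that [epsilon_trick0] sums. *)
have PF k : (P (F k) <= (2 / (2 ^ k.+1)%:R)%:E)%E.
  have [_ /le_trans] := pairwise_indep_chebyshev P A q _ (8 ^ k)%N (e0 k) mA PA PAA; apply.
  rewrite lee_fin le_eqVlt; apply/orP; left; apply/eqP.
  rewrite !natrX (exprS 2 k) (_ : 8 = 2 ^+ 3 :> R); last by rewrite -natrX.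
  rewrite -exprM mulnC exprM.
  have : (2 ^+ k : R) != 0 by rewrite expf_neq0.
  by move=> h; field; rewrite h.
(* First Borel-Cantelli lemma: almost every point lies in only finitely many [F k]. *)
have F0 : P (lim_sup_set F) = 0%E.
  apply: lim_sup_set_cvg0 => //.
  apply: (@le_lt_trans _ _ 2%:E); last by rewrite ltry.
  apply: le_trans (epsilon_trick0 xpredT _) => //.
  by apply: lee_nneseries => k *; [exact: measure_ge0|exact: PF].
have mlF : measurable (lim_sup_set F).
  by apply: bigcap_measurable => // n _; exact: bigcup_measurable.
exists (lim_sup_set F); split => // t /= nt; apply: contrapT => ntF; apply: nt.
have [N NF] : exists N, forall k, (N <= k)%N -> ~ F k t.
  apply: contrapT => h; apply: ntF => n _; apply: contrapT => h'; apply: h.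
  by exists n => k nk Fk; apply: h'; exists k.
apply/subr_cvg0/norm_cvg0P.
apply: (@squeeze_cvgr _ _ _ _ (cst 0) (fun k => 2^-1 ^+ k)).
- exists N => // k /NF /negP; rewrite -ltNge normr_ge0/= => SF.
  have m0 : 0 < (8 ^ k)%:R :> R by rewrite ltr0n expn_gt0.
  have SE : S (8 ^ k)%N t = \sum_(j < 8 ^ k) \1_(A j) t - (8 ^ k)%:R * q.
    by rewrite /S sumrB sumr_const card_ord mulr_natl.
  have -> : (8 ^ k)%:R^-1 * \sum_(j < 8 ^ k) \1_(A j) t - q =
      (8 ^ k)%:R^-1 * S (8 ^ k)%N t.
    by rewrite SE mulrBr mulKf// gt_eqF.
  rewrite normrM gtr0_norm ?invr_gt0// mulrC ler_pdivrMr//.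
  by rewrite (le_trans (ltW SF))// mulrC natrX exprVn.
- exact: cvg_cst.
- by apply: cvg_expr; rewrite gtr0_norm// invf_lt1// ltr1n.
Qed.

(** * Finite partitions generated by a sequence of sets *)

Definition code {T : Type} (B : nat -> set T) n (w : T) : {ffun 'I_n -> bool} :=
  [ffun i : 'I_n => `[< B i w >]].

(** All Boolean words index atoms, including words whose atom is empty, so sums over the partition
    are plain sums over a finite type. *)
Definition atom {T : Type} (B : nat -> set T) n (s : {ffun 'I_n -> bool}) :
  set T := [set w | code B n w = s].

Lemma measurable_atom {d} {T : measurableType d} (B : nat -> set T) n
    (s : {ffun 'I_n -> bool}) :
  (forall i, measurable (B i)) -> measurable (atom B n s).
Proof.
move=> mB.
have -> : atom B n s = \bigcap_(i in [set: 'I_n]) (if s i then B i else ~` B i).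
  apply/seteqP; split => [w <- i _|w wB].
    rewrite ffunE; case: asboolP => //.
  apply/ffunP => i; rewrite ffunE; have := wB i I.
  by case: (s i) => h; [exact/asboolP|exact/asboolPn].
apply: fin_bigcap_measurable; first exact: finite_finset.
by move=> i _; case: (s i) => //; exact: measurableC.
Qed.

(** Exactly one atom contains [w]. This turns any function of the code into a linear combination of
    indicators. *)
Lemma sum_indic_atom {R : realType} {T : Type} (B : nat -> set T) n
    (c : {ffun 'I_n -> bool} -> R) (w : T) :
  \sum_s c s * \1_(atom B n s) w = c (code B n w).
Proof.
rewrite (bigD1 (code B n w))//= big1 ?addr0 => [|s sw].
  by rewrite indicE mem_set// mulr1.
by rewrite indicE memNset ?mulr0// /atom/= => ws; rewrite ws eqxx in sw.
Qed.

(** Dropping the last bits expresses refinement: the level-[n] atom of [s] lies in the level-[k]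
    atom of [coarsen kn s]. *)
Definition coarsen {n k} (kn : (k <= n)%N) (s : {ffun 'I_n -> bool}) :
  {ffun 'I_k -> bool} := [ffun i => s (widen_ord kn i)].

Lemma coarsen_code {T : Type} (B : nat -> set T) n k (kn : (k <= n)%N) (w : T) :
  coarsen kn (code B n w) = code B k w.
Proof. by apply/ffunP => i; rewrite !ffunE. Qed.

Lemma sum_measure_atom {d} {T : measurableType d} {R : realType}
    (mu : probability T R) (B : nat -> set T) n (A : set T) :
  (forall i, measurable (B i)) -> measurable A ->
  \sum_s fine (mu (A `&` atom B n s)) = fine (mu A).
Proof.
move=> mB mA; have mAs s : measurable (A `&` atom B n s).
  by apply: measurableI => //; exact: measurable_atom.
under eq_bigr do rewrite -Rintegral_indic_setT//.
rewrite -Rintegral_indic_setT// -Rintegral_sum//; last first.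
  by move=> s; exact: bounded_measurable_indic.
apply: eq_Rintegral => w _; under eq_bigr do rewrite indicI/=.
exact: sum_indic_atom (fun=> \1_A w) w.
Qed.

(** * Weighted empirical means and their weak limit *)

(** The sample size is [8 ^ k], to match the law of large numbers. With weights [fun=> 1] and an
    indicator this is an empirical frequency. *)
Definition weighted_mean {R : realType} {T : Type} (a : nat -> R) (w : nat -> T)
  (h : T -> R) (k : nat) : R :=
  (8 ^ k)%:R^-1 * \sum_(j < 8 ^ k) a j * h (w j).

(** Taking [g] an indicator gives domination by frequencies; taking [g] constant gives uniform
    bounds. *)
Lemma le_norm_weighted_mean {R : realType} {T : Type} (a : nat -> R)
    (w : nat -> T) (h g : T -> R) (C : R) (k : nat) :
  (forall j, `|a j| <= C) -> (forall j, `|h (w j)| <= g (w j)) ->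
  `|weighted_mean a w h k| <= C * weighted_mean (fun=> 1) w g k.
Proof.
move=> aC hg; rewrite /weighted_mean normrM ger0_norm ?invr_ge0//.
rewrite mulrCA ler_wpM2l ?invr_ge0// (le_trans (ler_norm_sum _ _ _))//.
rewrite mulr_sumr ler_sum// => j _.
by rewrite mul1r normrM ler_pM.
Qed.

Lemma weighted_mean1_cst {R : realType} {T : Type} (w : nat -> T) (c : R) (k : nat) :
  weighted_mean (fun=> 1) w (fun=> c) k = c.
Proof.
rewrite /weighted_mean; under eq_bigr do rewrite mul1r.
by rewrite sumr_const card_ord -[c *+ _]mulr_natl mulKf// pnatr_eq0 expn_eq0.
Qed.

Lemma bounded_weighted_mean {R : realType} {T : Type} (a : nat -> R)
    (w : nat -> T) (h : T -> R) (C M : R) :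
  (forall j, `|a j| <= C) -> (forall j, `|h (w j)| <= M) ->
  bounded_seq (weighted_mean a w h).
Proof.
move=> aC hM; exists (C * M) => k.
rewrite (le_trans (le_norm_weighted_mean a w h (fun=> M) C k aC hM))//.
by rewrite weighted_mean1_cst.
Qed.

Lemma weighted_mean_sum {R : realType} {T : Type} (a : nat -> R) (w : nat -> T)
    {I : Type} (s : seq I) (c : I -> R) (h : I -> T -> R) (k : nat) :
  weighted_mean a w (fun x => \sum_(i <- s) c i * h i x) k =
  \sum_(i <- s) c i * weighted_mean a w (h i) k.
Proof.
rewrite /weighted_mean; under eq_bigr do rewrite mulr_sumr.
rewrite exchange_big mulr_sumr; apply: eq_bigr => i _.
rewrite mulrCA; congr (_ * _); rewrite mulr_sumr.
by apply: eq_bigr => j _; rewrite mulrCA.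
Qed.

(** [L] acts twice: on the sample index, giving [nu0] on atoms, and on the partition level, giving
    [nu] on measurable sets. The frequencies enter through [nu0C]. *)
Lemma weak_limit_density {d} {T : measurableType d} {R : realType}
    (mu : probability T R) (B : nat -> set T) (L : (nat -> R) -> R)
    (a : nat -> R) (w : nat -> T) (C : R) :
  (forall i, measurable (B i)) -> generalized_limit L ->
  (forall j, `|a j| <= C) ->
  (forall n s, weighted_mean (fun=> 1) w \1_(atom B n s) @ \oo -->
     fine (mu (atom B n s))) ->
  exists b : T -> R, [/\ measurable_fun setT b, forall x, `|b x| <= C &
    forall n s, \int[mu]_(x in atom B n s) b x =
      L (weighted_mean a w \1_(atom B n s))].
Proof.
move=> mB gL aC freq; have [Llin Lle Lcvg] := gL.
have C0 : 0 <= C by exact: le_trans (aC 0%N).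
have mQ n s : measurable (atom B n s) by exact: measurable_atom.
have mfin A : measurable A -> (fine (mu A))%:E = mu A.
  by move=> mA; rewrite fineK// fin_num_measure.
have m0 A : 0 <= fine (mu A) by rewrite fine_ge0.
have mS A A' : measurable A -> measurable A' -> A `<=` A' ->
    fine (mu A) <= fine (mu A').
  by move=> mA mA' AA'; rewrite -lee_fin !mfin// le_measure ?inE.
have ind01 (A : set T) x : `|\1_A x : R| <= \1_A x.
  by rewrite ger0_norm// indicE.
have bwm A : bounded_seq (weighted_mean a w (\1_A : T -> R)).
  apply: (bounded_weighted_mean a w _ C 1) => // j.
  by rewrite indicE; case: (_ \in _); rewrite ?normr1 ?normr0.
pose nu0 n s := L (weighted_mean a w \1_(atom B n s)).
have nu0C n s : `|nu0 n s| <= C * fine (mu (atom B n s)).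
  (* The slack [e] absorbs the gap between the frequency at a large finite [k] and its limit. *)
  apply/ler_addgt0Pr => e e0; apply: Lle.
  have : (fun k => C * weighted_mean (fun=> 1) w \1_(atom B n s) k) @ \oo -->
      C * fine (mu (atom B n s)).
    by apply: cvgM; [exact: cvg_cst|exact: freq].
  move=> /cvgrPdist_le /(_ e e0); apply: filterS => k.
  rewrite ler_norml => /andP[+ _]; rewrite lerNl opprB lerBlDl => /(le_trans _).
  apply; exact: le_norm_weighted_mean.
(* An atom of measure zero contributes 0, since division by 0 yields 0. *)
pose p A n := \sum_s nu0 n s / fine (mu (atom B n s)) *
  fine (mu (A `&` atom B n s)).
have pC A n : measurable A -> `|p A n| <= C * fine (mu A).
  move=> mA; rewrite -(sum_measure_atom mu B n A mB mA) mulr_sumr.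
  rewrite (le_trans (ler_norm_sum _ _ _))// ler_sum// => s _.
  rewrite normrM (ger0_norm (m0 _)) ler_wpM2r//.
  rewrite normrM normfV (ger0_norm (m0 _)).
  have [->|nz] := eqVneq (fine (mu (atom B n s))) 0; first by rewrite invr0 mulr0.
  by rewrite ler_pdivrMr// lt0r nz m0.
have bp A : measurable A -> bounded_seq (p A).
  by move=> mA; exists (C * fine (mu A)) => n; exact: pC.
pose nu A := L (p A).
have nuU A A' : measurable A -> measurable A' -> A `&` A' = set0 ->
    nu (A `|` A') = nu A + nu A'.
  move=> mA mA' AA'; rewrite -[nu A']mul1r -Llin; [|exact: bp|exact: bp].
  congr L; apply/funext => n; rewrite mul1r -big_split/=.
  apply: eq_bigr => s _; rewrite -mulrDr; congr (_ * _).
  apply: EFin_inj; rewrite EFinD !mfin; [|exact: measurableI..|]; last first.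
    by apply: measurableI => //; exact: measurableU.
  rewrite setIUl measureU//; [exact: measurableI|exact: measurableI|].
  by rewrite setIACA AA' set0I.
have nuC A : measurable A -> `|nu A| <= C * fine (mu A).
  by move=> mA; apply: Lle; apply: nearW => n; exact: pC.
have [b [mb bC bnu]] := bounded_charge_density mu nu C C0 nuU nuC.
exists b; split=> // k r; rewrite bnu//.
(* For [n >= k] each level-[n] atom lies inside [atom B k r] or misses it, so the sequence
   [p (atom B k r)] is constant from [k] on. *)
apply: Lcvg; apply: cvg_near_cst; exists k => // n /= kn.
have -> : weighted_mean a w \1_(atom B k r) = weighted_mean a w
    (fun x => \sum_s (coarsen kn s == r)%:R * \1_(atom B n s) x).
  congr weighted_mean; apply/funext => x.
  rewrite (sum_indic_atom B n (fun s => (coarsen kn s == r)%:R) x) coarsen_code.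
  by rewrite indicE; congr ((nat_of_bool _)%:R); apply/idP/eqP; rewrite inE.
rewrite (_ : weighted_mean _ _ _ = fun m => \sum_s (coarsen kn s == r)%:R *
    weighted_mean a w \1_(atom B n s) m); last first.
  by apply/funext => m; exact: weighted_mean_sum.
rewrite generalized_limit_sum//; apply: eq_bigr => s _.
have [sr|sr] := eqVneq (coarsen kn s) r; last first.
  rewrite mul0r (_ : _ `&` _ = set0) ?measure0 ?mulr0//.
  apply/seteqP; split => // x [/= xr xs].
  by move: sr; rewrite -xr -xs coarsen_code eqxx.
rewrite (setIidr _); last by move=> x; rewrite /atom/= -sr => <-; rewrite coarsen_code.
rewrite mul1r -/(nu0 n s).
(* On a null atom [nu0] vanishes by [nu0C], so the convention for division by 0 loses no mass. *)
have [m00|nz] := eqVneq (fine (mu (atom B n s))) 0; last by rewrite divfK.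
by have := nu0C n s; rewrite m00 !mulr0 normr_le0 => /eqP ->.
Qed.

Lemma Rintegral_setI_full {d} {T : measurableType d} {R : realType}
    (mu : probability T R) (D A : set T) (f : T -> R) :
  measurable D -> mu (~` D) = 0%E -> measurable A -> bounded_measurable f ->
  \int[mu]_(x in A `&` D) f x = \int[mu]_(x in A) f x.
Proof.
move=> mD D0 mA bf; rewrite Rintegral_mkcondr /Rintegral; congr fine.
have [mf _] := bf.
apply: ae_eq_integral => //.
- apply/measurable_EFinP/measurable_funTS.
  by apply/(measurable_restrictT f mD).1; exact: measurable_funTS mf.
- by apply/measurable_EFinP/measurable_funTS.
- exists (~` D); split => //; first exact: measurableC.
  move=> x /= /not_implyP[_ +] Dx; apply.
  by rewrite patchE mem_set.
Qed.

(** Both sides agree on functions constant on atoms, and both change by at most [C] times a uniform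
    error on [D]. The oscillation hypothesis approximates [f] uniformly on [D] by such functions. *)
Lemma weak_limit_integral {d} {T : measurableType d} {R : realType}
    (mu : probability T R) (B : nat -> set T) (L : (nat -> R) -> R)
    (a : nat -> R) (w : nat -> T) (C : R) (D : set T) (b f : T -> R) (M : R) :
  (forall i, measurable (B i)) -> generalized_limit L ->
  (forall j, `|a j| <= C) ->
  measurable D -> mu (~` D) = 0%E -> (forall j, D (w j)) ->
  measurable_fun setT b -> (forall x, `|b x| <= C) ->
  (forall n s, \int[mu]_(x in atom B n s) b x =
      L (weighted_mean a w \1_(atom B n s))) ->
  (forall x, D x -> `|f x| <= M) ->
  (forall e, 0 < e -> exists n, forall x y, D x -> D y ->
     code B n x = code B n y -> `|f x - f y| <= e) ->
  (\int[mu]_(x in D) (b x * f x)%:E)%E = (L (weighted_mean a w f))%:E.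
Proof.
move=> mB gL aC mD D0 wD mb bC bL fM fosc; have [Llin Lle Lcvg] := gL.
have C0 : 0 <= C by exact: le_trans (aC 0%N).
have mQ n s : measurable (atom B n s) by exact: measurable_atom.
(* The step function takes the value of [f] at a chosen point of [D] in the atom; the default [w 0]
   serves atoms that miss [D]. *)
pose c n s := f (xget (w 0%N) [set x | D x /\ code B n x = s]).
pose st n x := c n (code B n x).
have stE n : st n = fun x => \sum_s c n s * \1_(atom B n s) x.
  by apply/funext => x; rewrite sum_indic_atom.
have bmst n : bounded_measurable (st n).
  rewrite stE; apply: bounded_measurable_sum => s.
  apply: bounded_measurableM; first exact: bounded_measurable_cst.
  exact: bounded_measurable_indic.
have app e : 0 < e -> exists n, forall x, D x -> `|f x - st n x| <= e.
  move=> /fosc [n nP]; exists n => x Dx; rewrite /st /c.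
  have [Dy xy] := @xgetPex _ (w 0%N) [set y | D y /\ code B n y = code B n x]
    (ex_intro _ x (conj Dx erefl)).
  exact: nP.
(* On [D], [f] is a pointwise limit of measurable step functions. *)
have mf : measurable_fun D f.
  have /choice [n nP] : forall i, exists n, forall x, D x ->
      `|f x - st n x| <= i.+1%:R^-1.
    by move=> i; apply: app; rewrite invr_gt0.
  apply: (@measurable_fun_cvg _ _ _ _ (fun i => st (n i))).
    by move=> i; apply: measurable_funTS; case: (bmst (n i)).
  move=> x Dx; apply/subr_cvg0/norm_cvg0P.
  apply: (@squeeze_cvgr _ _ _ _ (cst 0) (fun i => i.+1%:R^-1)).
  - by apply: nearW => i; rewrite normr_ge0 distrC nP.
  - exact: cvg_cst.
  - exact: cvg_harmonic.
(* [f] is controlled only on [D]; its extension by zero is bounded and measurable everywhere. *)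
pose F := f \_ D.
have bmF : bounded_measurable F.
  split; first exact/(measurable_restrictT f mD).1.
  exists (Num.max M 0) => x; rewrite /F patchE; case: ifPn => [|_].
    by rewrite inE => Dx; rewrite le_max fM.
  by rewrite normr0 le_max lexx orbT.
have bmb : bounded_measurable b by split=> //; exists C.
have ib g := @bounded_measurable_integrable _ _ _ mu D g mD.
have intF : (\int[mu]_(x in D) (b x * f x)%:E)%E =
    (\int[mu]_(x in D) (b x * F x))%:E.
  rewrite /Rintegral fineK; last first.
    by apply: integrable_fin_num => //; apply/ib/bounded_measurableM.
  by apply: eq_integral => x xD; rewrite /F patchE xD.
rewrite intF; congr EFin.
have bwf : bounded_seq (weighted_mean a w f).
  by apply: (bounded_weighted_mean a w f C M) => // j; exact: fM.
have st_int n : \int[mu]_(x in D) (b x * st n x) = L (weighted_mean a w (st n)).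
  rewrite stE (_ : weighted_mean a w _ = fun m => \sum_s c n s *
    weighted_mean a w \1_(atom B n s) m); last first.
    by apply/funext => m; exact: weighted_mean_sum.
  rewrite generalized_limit_sum//; last first.
    move=> s; apply: (bounded_weighted_mean a w _ C 1) => // j.
    by rewrite indicE; case: (_ \in _); rewrite ?normr1 ?normr0.
  under eq_Rintegral do rewrite mulr_sumr.
  have bmbs s : bounded_measurable (fun x => b x * \1_(atom B n s) x).
    by apply: bounded_measurableM => //; exact: bounded_measurable_indic.
  have bms s : bounded_measurable (fun x => b x * (c n s * \1_(atom B n s) x)).
    apply: bounded_measurableM => //.
    apply: bounded_measurableM; first exact: bounded_measurable_cst.
    exact: bounded_measurable_indic.
  rewrite Rintegral_sum//; apply: eq_bigr => s _.
  under eq_Rintegral do rewrite mulrCA.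
  rewrite RintegralZl//; last exact: ib.
  (* [bL] integrates over the whole atom, while here the domain is cut by [D]; the difference is
     null. *)
  congr (_ * _); rewrite -bL -(Rintegral_setI_full mu D (atom B n s))//.
  rewrite setIC Rintegral_mkcondr; apply: eq_Rintegral => x _.
  by rewrite patchE indicE; case: ifPn => _; rewrite ?mulr1 ?mulr0.
apply/eqP; rewrite -subr_eq0 -normr_le0; apply/ler_addgt0Pr => e e0; rewrite add0r.
(* [C + 1] keeps the denominator positive when [C] is 0. The two errors below are at most [C * e']
   each, hence at most [e] together. *)
have e'0 : 0 < e / (2 * (C + 1)) by rewrite divr_gt0// mulr_gt0// ltr_wpDl.
have e'E : 2 * (C + 1) * (e / (2 * (C + 1))) = e.
  by rewrite mulrC divfK// mulf_neq0// gt_eqF// ltr_wpDl.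
move: (e / _) e'0 e'E => e' e'0 e'E; have [n nP] := app _ e'0.
have le1 : `|\int[mu]_(x in D) (b x * F x) - \int[mu]_(x in D) (b x * st n x)|
    <= C * e'.
  rewrite -RintegralB//; [|by apply/ib/bounded_measurableM..].
  have bd : bounded_measurable (fun x => b x * F x - b x * st n x).
    apply: bounded_measurableD; first exact: bounded_measurableM.
    under eq_fun do rewrite -mulN1r.
    apply: bounded_measurableM; first exact: bounded_measurable_cst.
    exact: bounded_measurableM.
  rewrite (le_trans (le_normr_Rintegral mD _))//; first exact: ib.
  rewrite -[leRHS](Rintegral_cst_setT mu) -(Rintegral_setI_full mu D setT)//; last first.
    exact: bounded_measurable_cst.
  rewrite setTI; apply: le_Rintegral => //.
  - apply: ib; case: bd => mbd [N bN]; split; first exact: measurableT_comp.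
    by exists N => x; rewrite normr_id.
  - by apply: ib; exact: bounded_measurable_cst.
  - move=> x Dx; rewrite -mulrBr normrM ler_pM//.
    by rewrite /F patchE mem_set// nP.
have le2 : `|L (weighted_mean a w f) - L (weighted_mean a w (st n))| <= C * e'.
  have bst : bounded_seq (weighted_mean a w (st n)).
    case: (bmst n) => _ [N sN].
    by apply: (bounded_weighted_mean a w _ C N).
  rewrite -mulN1r -Llin//; apply: Lle; apply: nearW => k.
  have -> : weighted_mean a w f k + -1 * weighted_mean a w (st n) k =
      weighted_mean a w (fun x => f x - st n x) k.
    rewrite mulN1r /weighted_mean -mulrBr -sumrB; congr (_ * _).
    by apply: eq_bigr => j _; rewrite mulrBr.
  rewrite (le_trans (le_norm_weighted_mean a w _ (fun=> e') C k aC _))//.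
    by move=> j; exact: nP.
  by rewrite weighted_mean1_cst.
rewrite (le_trans (ler_distD (L (weighted_mean a w (st n))) _ _))//.
rewrite -{1}st_int (distrC (L _)) (le_trans (lerD le1 le2))//.
by rewrite -e'E; nra.
Qed.

(** * Countable base, compactness and support *)

Lemma rV_countable_base (R : realType) (p : nat) :
  exists B : nat -> set 'rV[R]_p, (forall i, open (B i)) /\
    forall x U, nbhs x U -> exists i, B i x /\ B i `<=` U.
Proof.
(* Balls with rational centres and radii [1 / (k + 1)] have a countable index type; taking interiors
   makes them open at once. *)
pose box (ck : 'rV[rat]_p * nat) : set 'rV[R]_p :=
  (ball (map_mx ratr ck.1 : 'rV[R]_p) ck.2.+1%:R^-1)°.
pose B i := if unpickle i is Some ck then box ck else set0.
exists B; split=> [i|x U /nbhs_ballP[e /= e0 xeU]].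
  by rewrite /B; case: unpickle => [ck|]; [exact: open_interior|exact: open0].
(* With radius below [e / 2] and centre within half the radius of [x], the point [x] is interior to
   the ball, and the ball stays within [e] of [x]. *)
have [k ke] : exists k, k.+1%:R^-1 < e / 2.
  have e20 : 0 < e / 2 by rewrite divr_gt0.
  have /cvgrPdist_lt/(_ _ e20) [k _ /(_ k (leqnn k))] := @cvg_harmonic R.
  by rewrite /= sub0r normrN gtr0_norm ?invr_gt0// => h; exists k.
pose r : R := k.+1%:R^-1; have r0 : 0 < r by rewrite invr_gt0.
have /choice [c cP] : forall i, exists q : rat, `|ratr q - x ord0 i| < r / 2.
  move=> i; have /rat_in_itvoo [q] : x ord0 i - r / 2 < x ord0 i + r / 2.
    by rewrite ltrD2l gtrN// divr_gt0.
  by rewrite in_itv/= => h; exists q; rewrite ltr_distl.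
pose cx : 'rV[rat]_p := \row_i c i.
have bcx : ball (map_mx ratr cx : 'rV[R]_p) (r / 2) x.
  split; first by rewrite divr_gt0.
  by move=> i j; rewrite ord1 !mxE; exact: cP.
have r2 : r = r / 2 + r / 2 by rewrite -splitr.
exists (pickle (cx, k)); rewrite /B pickleK; split.
  apply/nbhs_ballP; exists (r / 2) => /=; first by rewrite divr_gt0.
  by move=> y xy; rewrite /= -/r r2; exact: ball_triangle xy.
apply: subset_trans (@interior_subset _ _) _ => y /= cy; apply: xeU.
have -> : e = e / 2 + e / 2 by rewrite -splitr.
apply: (@ball_triangle _ _ (map_mx ratr cx : 'rV[R]_p)).
  apply: ball_sym; apply: le_ball bcx.
  by move: ke; rewrite -/r; lra.
by apply: le_ball cy; exact: ltW.
Qed.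

(** By continuity, the base sets on which [g] oscillates by at most [e] cover [D]. A finite subcover
    uses finitely many bits of the code, and equal bits put both points in a common set of it. *)
Lemma compact_osc_code {R : realType} {S : ptopologicalType} (B : nat -> set S)
    (D : set S) (g : S -> R) :
  (forall i, open (B i)) ->
  (forall x U, nbhs x U -> exists i, B i x /\ B i `<=` U) ->
  compact D -> {within D, continuous g} ->
  forall e, 0 < e -> exists n, forall x y, D x -> D y ->
    code B n x = code B n y -> `|g x - g y| <= e.
Proof.
move=> oB baseB cD /subspace_continuousP cg e e0.
pose good := [set i | forall x y, D x -> D y -> B i x -> B i y -> `|g x - g y| <= e].
have cov : D `<=` cover good B.
  move=> x Dx; have e20 : 0 < e / 2 by rewrite divr_gt0.
  have /cvgrPdist_le/(_ _ e20) := cg x Dx.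
  move=> /baseB[i [Bix BiU]]; exists i => // y z Dy Dz /BiU gy /BiU gz.
  rewrite (le_trans (ler_distD (g x) _ _))// [leRHS]splitr lerD//.
    by rewrite distrC gy.
  exact: gz.
have [F Fgood DF] : finite_subset_cover good B D.
  by move: cD; rewrite compact_cover; apply.
(* The successor matters: [code B n] records only the indices below [n]. *)
exists (\max_(i <- finmap.enum_fset F) i).+1 => x y Dx Dy.
have [i /= iF Bix] := DF x Dx.
have lti : (i < (\max_(i <- finmap.enum_fset F) i).+1)%N by rewrite ltnS; exact: leq_bigmax_seq.
move=> /ffunP /(_ (Ordinal lti)); rewrite !ffunE/= => xyE.
have xy := asbool_eq_equiv xyE; have /Fgood := iF; rewrite inE => h; apply: h => //.
exact: xy.1.
Qed.

Lemma within_continuous_slice {R : realType} {X Y : topologicalType}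
    (A : set X) (D : set Y) (f : X * Y -> R) (x : X) :
  {within A `*` D, continuous f} -> A x ->
  {within D, continuous (fun y => f (x, y))}.
Proof.
move=> /subspace_continuousP cf Ax; apply/subspace_continuousP => y Dy V.
move=> /(cf (x, y) (conj Ax Dy)) [[U W]/= [xU yW] UWV].
apply: filterS yW => z Wz Dz; apply: (UWV (x, z)) => //.
by split => //; exact: nbhs_singleton.
Qed.

(** The complement of the support is the union of the null members of a countable base. *)
Lemma msupport_full (R : realType) (p : nat)
    (mu : probability (borel_rV R p) R) :
  measurable (msupport mu : set (borel_rV R p)) /\ mu (~` msupport mu) = 0%E.
Proof.
have [B [oB baseB]] := rV_countable_base R p.
have mopen (U : set (borel_rV R p)) : open (U : set 'rV[R]_p) -> measurable U.
  by move=> oU; exact: sub_sigma_algebra.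
pose N i := if `[< mu (B i) = 0%E >] then B i else set0.
have mN i : measurable (N i : set (borel_rV R p)).
  by rewrite /N; case: asboolP => _; [exact: mopen|exact: measurable0].
have suppE : ~` msupport mu = \bigcup_i N i.
  apply/seteqP; split=> [x|x [i _]]; last first.
    rewrite /N; case: asboolP => // Bi0 Bix /(_ (B i) (oB i) Bix).
    by rewrite Bi0 ltxx.
  move=> /existsNP[U /not_implyP[oU /not_implyP[Ux /negP]]].
  rewrite -leNgt => U0.
  have [i [Bix BiU]] := baseB x U (open_nbhs_nbhs (conj oU Ux)).
  exists i => //; rewrite /N asboolT//; apply/eqP.
  rewrite eq_le measure_ge0 andbT.
  by rewrite (le_trans _ U0)// le_measure ?inE//; exact: mopen.
split.
  rewrite -[msupport mu]setCK suppE; apply: measurableC.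
  exact: bigcup_measurable.
rewrite suppE; apply/negligibleP; first exact: bigcup_measurable.
apply: negligible_bigcup => i; apply/negligibleP => //; rewrite /N.
by case: asboolP => // _; exact: measure0.
Qed.

(** * Application to the random sample *)

Lemma iid_seq_slln {R : realType} {dT : measure_display} {T : measurableType dT}
    (P : probability T R) {p : nat} (mu : probability (borel_rV R p) R)
    (W : nat -> T -> borel_rV R p) (A : set (borel_rV R p)) :
  iid_seq P mu W -> measurable A ->
  {ae P, forall t, weighted_mean (fun=> 1) (W ^~ t) \1_A @ \oo --> fine (mu A)}.
Proof.
move=> [mW [PW indep]] mA.
have mWA j : measurable (W j @^-1` A) by rewrite -[X in measurable X]setTI; exact: mW.
have muA : (fine (mu A))%:E = mu A by rewrite fineK// fin_num_measure.
apply: filterS (pairwise_indep_slln P (fun j => W j @^-1` A) (fine (mu A)) mWA _ _).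
- move=> t; rewrite (_ : weighted_mean _ _ _ = fun k =>
    (8 ^ k)%:R^-1 * \sum_(j < 8 ^ k) \1_(W j @^-1` A) t)//; apply/funext => k.
  by congr (_ * _); apply: eq_bigr => j _; rewrite mul1r.
- by move=> j; rewrite PW.
(* Pairwise independence is the product rule for the list [[:: i; j]] with a constant family of
   sets. *)
- move=> i j ij; have := indep [:: i; j] (fun=> A).
  rewrite /= inE ij /= => /(_ isT (fun _ _ => mA)).
  rewrite !big_cons big_nil mule1 !PW// EFinM muA => <-; congr (P _).
  apply/seteqP; split => [t [iA jA] k/=|t kA].
    by rewrite !inE => /orP[] /eqP ->.
  by split; apply: (kA _); rewrite /= !inE eqxx ?orbT.
Qed.

Theorem mainTheorem2 (R : realType) (d p : nat)
  (Omega : set 'rV[R]_p) (pi0 : probability (borel_rV R p) R)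
  (phi : 'rV[R]_d * 'rV[R]_p -> R)
  (dT : measure_display) (T : measurableType dT) (P : probability T R)
  (W : nat -> T -> borel_rV R p) (fstar : 'rV[R]_d -> R) :
  compact Omega ->
  msupport pi0 = Omega ->
  {within unit_cube R d `*` Omega, continuous phi} ->
  (exists M : R, forall x w, unit_cube R d x -> Omega w -> `|phi (x, w)| <= M) ->
  iid_seq P pi0 W ->
  {within unit_cube R d, continuous fstar} ->
  {ae P, forall t, forall (C : R) (a : nat -> R),
     (forall j, `|a j| <= C) ->
     (forall x, unit_cube R d x ->
        (fun m : nat => m%:R^-1 * \sum_(j < m) a j * phi (x, W j t))
          @ \oo --> fstar x) ->
     exists astar : borel_rV R p -> R,
       measurable_fun setT astar /\
       {ae pi0, forall w, `|astar w| <= C} /\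
       (forall x, unit_cube R d x ->
          (\int[pi0]_(w in Omega) (astar w * phi (x, w))%:E)%E = (fstar x)%:E)}.
Proof.
move=> cOm suppE cphi [M phiM] iid _.
have [mOm Om0] := msupport_full R p pi0; rewrite suppE in mOm Om0.
have [B [oB baseB]] := rV_countable_base R p.
have mB i : measurable (B i : set (borel_rV R p)) by exact: sub_sigma_algebra.
(* There are countably many atoms, so one null set serves all of them; it is fixed before [C], [a]
   and [x] are given. *)
have freq : {ae P, forall t, forall n (s : {ffun 'I_n -> bool}),
    weighted_mean (fun=> 1) (W ^~ t) \1_(atom (B : nat -> set (borel_rV R p)) n s)
      @ \oo --> fine (pi0 (atom B n s))}.
  apply/ae_foralln => n; apply: filter_forall => s.
  by apply: iid_seq_slln => //; exact: measurable_atom.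
have WOm : {ae P, forall t, forall j, Omega (W j t)}.
  have [mW [PW _]] := iid.
  apply/ae_foralln => j; exists (W j @^-1` (~` Omega)); split => //.
  - by rewrite -[X in measurable X]setTI; apply: mW => //; exact: measurableC.
  - by apply: etrans (PW j (~` Omega) _) Om0; exact: measurableC.
apply: filterS2 freq WOm => t freq WOm C a aC lima.
have [L gL] := ex_generalized_limit R; have [_ _ Lcvg] := gL.
have [b [mb bC bL]] := weak_limit_density pi0 B L a (W ^~ t) C mB gL aC freq.
exists b; split=> //; split; first exact: aeW.
move=> x cx.
rewrite (weak_limit_integral pi0 B L a (W ^~ t) C Omega b (fun w => phi (x, w)) M)//.
- congr EFin; apply: Lcvg.
  (* Convergence along all sample sizes implies convergence along the sizes [8 ^ k], where [L]
     returns the true limit. *)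
  have pow8 : (fun k => 8 ^ k)%N @ \oo --> \oo.
    apply/cvgnyPge => N; exists N => // k /= Nk.
    by rewrite (leq_trans Nk)// ltnW// ltn_expl.
  exact: (cvg_comp _ _ pow8 (lima x cx)).
- by move=> w Omw; exact: phiM.
- apply: (@compact_osc_code R 'rV[R]_p) => //.
  exact: within_continuous_slice cphi cx.
Qed.
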